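(* Consider the linear model $\mathbf{y}=\mathbf{X}\boldsymbol\beta_0+\boldsymbol\varepsilon$, where $\mathbf{X}=(\mathbf{x}_1,\dots,\mathbf{x}_p)$ is a deterministic $n\times p$ design matrix with $\|\mathbf{x}_j\|_2=n^{1/2}$ for all $j$, $\boldsymbol\beta_0\in\mathbb{R}^p$ is the true coefficient vector with $s=\|\boldsymbol\beta_0\|_0$, and $\boldsymbol\varepsilon\sim N(\mathbf{0},\sigma^2I_n)$ for some $\sigma>0$. Let $\widetilde p=n\vee p$. Fix a constant $c>0$ and let $M=\mathrm{rspark}_c(\mathbf{X})$ be the robust spark of $\mathbf{X}$ with bound $c$. Assume (in an asymptotic regime $n\to\infty$) that $s<M/2$, $s=o(n)$, and $$b_0:=\min_{j\in\mathrm{supp}(\boldsymbol\beta_0)}|\beta_{0,j}|>\left(\sqrt{16/c^2}\vee1\right)c^{-1}c_2\sqrt{(2s+1)(\log\widetilde p)/n}$$ for some constant $c_2\ge\sqrt{10}\,\sigma$. Suppose the regularization parameter satisfies $$c^{-1}c_2\sqrt{(2s+1)(\log\widetilde p)/n}<\lambda<b_0\left(1\wedge\sqrt{c^2/2}\right).$$ Let $p_\lambda$ be either the hard-thresholding penalty $p_{H,\lambda}(t)=\tfrac12[\lambda^2-(\lambda-t)_+^2]$ or the $L_0$-penalty $p_{H_0,\lambda}(t)=\tfrac12\lambda^21_{\{t\ne0\}}$ ($t\ge0$), and let $$\hat{\boldsymbol\beta}=\arg\min_{\boldsymbol\beta\in\mathbb{S}_{M/2}}Q(\boldsymbol\beta),\qquad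 Q(\boldsymbol\beta)=(2n)^{-1}\|\mathbf{y}-\mathbf{X}\boldsymbol\beta\|_2^2+\sum_{j=1}^p p_\lambda(|\beta_j|),$$ where $\mathbb{S}_{M/2}=\{\boldsymbol\beta\in\mathbb{R}^p:\|\boldsymbol\beta\|_0<M/2\}$. Then, for both penalties, with probability at least $$1-(2/\pi)^{1/2}c_2^{-1}\sigma(\log\widetilde p)^{-1/2}\widetilde p^{\,1-c_2^2/(2\sigma^2)}-(2/\pi)^{1/2}c_2'^{-1}\sigma s(\log n)^{-1/2}n^{-c_2'^2/(2\sigma^2)}$$ for some positive constant $c_2'\ge\sqrt2\,\sigma$, the following hold simultaneously: (a) $\mathrm{supp}(\hat{\boldsymbol\beta})=\mathrm{supp}(\boldsymbol\beta_0)$; (b) $n^{-1/2}\|\mathbf{X}(\hat{\boldsymbol\beta}-\boldsymbol\beta_0)\|_2\le 2c_2'c^{-1}\sqrt{s(\log n)/n}$; (c) $\|\hat{\boldsymbol\beta}-\boldsymbol\beta_0\|_q\le 2c^{-2}c_2's^{1/q}\sqrt{(\log n)/n}$ for all $q\in[1,2]$, and $\|\hat{\boldsymbol\beta}-\boldsymbol\beta_0\|_\infty\le 2c^{-2}c_2's^{1/2}\sqrt{(\log n)/n}$.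
   Context: Robust spark: for an $n\times p$ matrix $\mathbf{X}$ and $c>0$, $\mathrm{rspark}_c(\mathbf{X})$ is the smallest number $\tau$ such that there exists a subgroup of $\tau$ columns of $n^{-1/2}\mathbf{X}$ whose corresponding submatrix has a singular value less than $c$; equivalently, it is the largest $\tau$ with $\min_{\|\boldsymbol\delta\|_0<\tau,\ \|\boldsymbol\delta\|_2=1}n^{-1/2}\|\mathbf{X}\boldsymbol\delta\|_2\ge c$. $\mathrm{supp}(\boldsymbol\beta)=\{j:\beta_j\ne0\}$, $\|\boldsymbol\beta\|_0=|\mathrm{supp}(\boldsymbol\beta)|$, $a\vee b=\max(a,b)$, $a\wedge b=\min(a,b)$, $(x)_+=\max(x,0)$. $\hat{\boldsymbol\beta}$ denotes a global minimizer of $Q$ over $\mathbb{S}_{M/2}$. *)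

(* Defs.v *)
From HB Require Import structures.
From mathcomp Require Import all_boot all_order all_algebra.
From mathcomp Require Import all_classical all_reals all_analysis.
From mathcomp Require Import normal_distribution.

Set Implicit Arguments.
Unset Strict Implicit.
Unset Printing Implicit Defensive.

Import Order.TTheory GRing.Theory Num.Theory.
Local Open Scope classical_set_scope.
Local Open Scope ring_scope.

Section Defs.
Variable R : realType.

Definition supp {p : nat} (b : 'cV[R]_p) : {set 'I_p} := [set j | b j 0 != 0].
Definition l0 {p : nat} (b : 'cV[R]_p) : nat := #|supp b|.

Definition l2norm {m : nat} (v : 'cV[R]_m) : R := Num.sqrt (\sum_i (v i 0) ^+ 2).
Definition lqnorm {m : nat} (q : R) (v : 'cV[R]_m) : R :=
  (\sum_i (`|v i 0| `^ q)) `^ (q^-1).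
Definition linfnorm {m : nat} (v : 'cV[R]_m) : R := \big[Num.max/0]_i `|v i 0|.

(* Robust spark: the largest tau (at most p+1) such that
   min_{||delta||_0 < tau, ||delta||_2 = 1} n^{-1/2} ||X delta||_2 >= c,
   equivalently the smallest tau such that some tau columns of n^{-1/2} X
   form a submatrix with a singular value < c (p+1 if no such tau). *)
Definition rspark_ok {n p : nat} (c : R) (X : 'M[R]_(n, p)) (tau : nat) : Prop :=
  forall delta : 'cV[R]_p, (l0 delta < tau)%N -> l2norm delta = 1 ->
    c <= (Num.sqrt n%:R)^-1 * l2norm (X *m delta).
Definition rspark {n p : nat} (c : R) (X : 'M[R]_(n, p)) : nat :=
  \big[maxn/0%N]_(tau < p.+2 | `[< rspark_ok c X tau >]) (tau : nat).

Inductive penalty_kind := HardPen | L0Pen.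
Definition pen (k : penalty_kind) (lam t : R) : R :=
  match k with
  | HardPen => (lam ^+ 2 - (Num.max (lam - t) 0) ^+ 2) / 2
  | L0Pen => if t != 0 then lam ^+ 2 / 2 else 0
  end.

Definition Qobj {n p : nat} (k : penalty_kind) (lam : R) (X : 'M[R]_(n, p))
  (y : 'cV[R]_n) (b : 'cV[R]_p) : R :=
  (2 * n%:R)^-1 * (l2norm (y - X *m b)) ^+ 2 + \sum_j pen k lam `|b j 0|.

Definition is_global_min {n p : nat} (k : penalty_kind) (lam : R) (M : nat)
  (X : 'M[R]_(n, p)) (y : 'cV[R]_n) (b : 'cV[R]_p) : Prop :=
  (2 * l0 b < M)%N /\
  forall b' : 'cV[R]_p, (2 * l0 b' < M)%N -> Qobj k lam X y b <= Qobj k lam X y b'.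

End Defs.

Section Noise.
Context {R : realType} {d : measure_display} {T : measurableType d}.
Variable P : probability T R.

Definition gaussian_noise {n : nat} (sigma : R) (eps : 'I_n -> {RV P >-> R}) : Prop :=
  (forall i (A : set R), measurable A -> P (eps i @^-1` A) = normal_prob 0 sigma A)
  /\ (forall B : 'I_n -> set R, (forall i, measurable (B i)) ->
        P (\bigcap_(i in [set: 'I_n]) (eps i @^-1` B i))
        = (\prod_(i < n) P (eps i @^-1` B i))%E).

Definition noise_vec {n : nat} (eps : 'I_n -> {RV P >-> R}) (w : T) : 'cV[R]_n :=
  \col_i eps i w.
End Noise.

Arguments gaussian_noise {R d T} P {n} sigma eps.

(* Main.v *)
(** On the event that [|x_j^T eps|] is at most [c2 sqrt (n log pt)] for every
column and at most [c2' sqrt (n log n)] for the columns of the true support,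
everything is deterministic.  Coordinatewise optimality forces every nonzero
entry of a minimizer to have modulus at least [lam] (with a tie to be excluded
for the hard-thresholding penalty), so its penalty is
[lam^2/2] times the size of its support; comparing [Q] at the minimizer and at
[beta0] then excludes first too large a support, and next a missed signal.  Once
the supports agree the penalties cancel, and the robust spark turns the
prediction bound into estimation bounds.  Each [x_j^T eps] is
[N(0, n sigma^2)], so the Mills-ratio tail bound and a union bound give the
probability. *)

Require Import Defs.
From HB Require Import structures.
From mathcomp Require Import all_boot all_order all_algebra.
From mathcomp Require Import all_classical all_reals all_analysis.
From mathcomp Require Import normal_distribution.
From mathcomp Require Import measurable_realfun.
From mathcomp Require Import ring lra.

Set Implicit Arguments.
Unset Strict Implicit.
Unset Printing Implicit Defensive.

Import Order.TTheory GRing.Theory Num.Theory.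
Import numFieldNormedType.Exports.
Local Open Scope classical_set_scope.
Local Open Scope ring_scope.

(** * Linear combinations of Gaussian noise *)

(** Both measures give every half-open interval its length, and this determines Lebesgue measure. *)
Lemma lebesgue_measure_translation (R : realType) (t : R) (A : set R) :
  measurable A ->
  pushforward lebesgue_measure ((fun x => x + t) : _ -> measurableTypeR R) A =
  lebesgue_measure A.
Proof.
move=> mA; apply/esym/lebesgue_measure_unique => //=; first exact: measurable_funD.
move=> mf _ [[a b]] _ <-; rewrite /pushforward.
have -> : (fun x => x + t) @^-1` [set` `]a, b]] = [set` `]a - t, b - t]].
  by apply/seteqP; split=> x /=; rewrite !in_itv/= ltrBlDr lerBrDr.
by rewrite /= !lebesgue_measure_itv/= !lte_fin ltrD2r -!EFinB; congr (if _ then _%:E else _); ring.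
Qed.

Lemma normal_prob_translation (R : realType) (s t : R) (A : set R) :
  s != 0 -> measurable A ->
  normal_prob 0 s ((fun x => x + t) @^-1` A) = normal_prob t s A.
Proof.
move=> s0 mA; rewrite /normal_prob.
have mt : measurable_fun setT ((fun x => x + t) : _ -> measurableTypeR R).
  exact: measurable_funD.
transitivity (\int[pushforward lebesgue_measure
    ((fun x => (x + t)%R) : _ -> measurableTypeR R)]_(x in A) (normal_pdf t s x)%:E)%E.
  rewrite ge0_integral_pushforward//; last 2 first.
  - by apply/measurable_EFinP/measurable_funTS; exact: measurable_normal_pdf.
  - by move=> x _; rewrite lee_fin normal_pdf_ge0.
  apply: eq_integral => x _ /=.
  by rewrite !normal_pdfE//= /normal_fun addrK subr0.
apply: eq_measure_integral => //= B mB _.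
exact: lebesgue_measure_translation.
Qed.

(** The Radon-Nikodym derivative of [normal_prob m s] and the function [normal_pdf m s] have equal
    integrals over every measurable set, hence agree almost everywhere. *)
Lemma ge0_integral_normal_prob (R : realType) (m s : R) (f : R -> \bar R) :
  measurable_fun setT f -> (forall x, 0 <= f x)%E ->
  (\int[normal_prob m s]_x f x =
   \int[lebesgue_measure]_x (f x * (normal_pdf m s x)%:E))%E.
Proof.
move=> mf f0.
have dom := normal_prob_dominates m s.
rewrite -(Radon_Nikodym_SigmaFinite.change_of_variables dom)//.
have mN : measurable_fun setT (fun x : R => (normal_pdf m s x)%:E).
  by apply/measurable_EFinP; exact: measurable_normal_pdf.
have iRN := Radon_Nikodym_SigmaFinite.f_integrable dom.
have mRN := measurable_int _ iRN.
apply: ae_eq_integral => //.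
- exact: emeasurable_funM.
- exact: emeasurable_funM.
apply: ae_eqe_mul2l.
apply: integral_ae_eq => // E _ mE.
by rewrite -Radon_Nikodym_SigmaFinite.f_integral.
Qed.

(* Completing the square: a Gaussian density in [z] times one in [y] with respect
   to which [z] is centered at [a y], rewritten with the roles exchanged. *)
Lemma normal_pdf_mul (R : realType) (s v a y z : R) : 0 < s -> 0 < v ->
  let w := Num.sqrt (v ^+ 2 + a ^+ 2 * s ^+ 2) in
  normal_pdf (a * y) v z * normal_pdf 0 s y =
  normal_pdf 0 w z * normal_pdf (a * s ^+ 2 / w ^+ 2 * z) (v * s / w) y.
Proof.
move=> s0 v0 w.
have W0 : 0 < v ^+ 2 + a ^+ 2 * s ^+ 2.
  by rewrite ltr_pwDl ?exprn_gt0// mulr_ge0// sqr_ge0.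
have w0 : 0 < w by rewrite sqrtr_gt0.
have w2 : w ^+ 2 = v ^+ 2 + a ^+ 2 * s ^+ 2 by rewrite sqr_sqrtr// ltW.
rewrite !normal_pdfE ?gt_eqF// ?divr_gt0 ?mulr_gt0//.
rewrite mulrACA [RHS]mulrACA; congr (_ * _).
  rewrite /normal_peak -!invfM -!sqrtrM ?mulrn_wge0 ?mulr_ge0 ?sqr_ge0 ?pi_ge0 ?ltW//.
  congr (Num.sqrt _)^-1; rewrite expr_div_n; field.
  by rewrite gt_eqF.
rewrite /normal_fun -!expRD; congr expR.
rewrite expr_div_n w2; field.
by rewrite exprMn !gt_eqF.
Qed.

(** The exchange of [normal_pdf_mul] turns the double integral into the density of the sum times a
    probability density in the other variable, which integrates to 1 once Tonelli's theorem has
    swapped the order. *)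
Lemma normal_prob_convolution (R : realType) (s v a : R) (A : set R) :
  0 < s -> 0 < v -> measurable A ->
  (normal_prob 0 s \x normal_prob 0 v)%E [set z | A (z.2 + a * z.1)] =
  normal_prob 0 (Num.sqrt (v ^+ 2 + a ^+ 2 * s ^+ 2)) A.
Proof.
move=> s0 v0 mA; set w := Num.sqrt _.
have mh : measurable_fun setT (fun z : R * R => z.2 + a * z.1).
  by apply: measurable_funD => //; apply: measurable_funM.
have mX : measurable [set z : R * R | A (z.2 + a * z.1)].
  by rewrite -[X in measurable X]setTI; exact: mh.
rewrite /product_measure1 ge0_integral_normal_prob//; last first.
  exact: measurable_fun_xsection.
(* The integrand after the exchange, at pairs [(y, z)] with [z] the value of the combination:
   indicator of [A], marginal density of [z], conditional density of [y] given [z]. *)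
pose F (u : R * R) := ((\1_A u.2)%:E *
  ((normal_pdf 0 w u.2)%:E * (normal_pdf (a * s ^+ 2 / w ^+ 2 * u.2) (v * s / w) u.1)%:E))%E.
have mpdf (S : R) (S0 : S != 0) (f g : R * R -> R) :
    measurable_fun setT f -> measurable_fun setT g ->
    measurable_fun setT (fun u => normal_pdf (f u) S (g u)).
  move=> mf mg; under eq_fun do rewrite normal_pdfE//.
  apply: measurable_funM => //; apply: measurableT_comp => //.
  apply: measurable_funM => //; apply: measurableT_comp => //.
  by apply: measurable_funX; exact: measurable_funB.
have W0 : 0 < v ^+ 2 + a ^+ 2 * s ^+ 2.
  by rewrite ltr_pwDl ?exprn_gt0// mulr_ge0// sqr_ge0.
have w0 : 0 < w by rewrite sqrtr_gt0.
have mF : measurable_fun setT F.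
  apply: emeasurable_funM; first by apply/measurable_EFinP; apply: measurableT_comp.
  apply: emeasurable_funM; apply/measurable_EFinP; apply: mpdf => //.
  - by rewrite gt_eqF.
  - by rewrite gt_eqF// divr_gt0// mulr_gt0.
  - exact: measurable_funM.
transitivity (\int[lebesgue_measure]_y \int[lebesgue_measure]_z F (y, z))%E.
  apply: eq_integral => y _; rewrite /=.
  (* The section over [y] is a translate of [A], so its probability is that of [A] under the law
     centered at [a * y]. *)
  rewrite (_ : xsection _ y = (fun x => x + a * y) @^-1` A); last first.
    by apply/seteqP; split => x; rewrite /xsection/= inE.
  rewrite normal_prob_translation ?gt_eqF// /normal_prob integral_mkcond.
  rewrite -ge0_integralZr//; last 3 first.
  - apply/(measurable_restrictT _ mA)/measurable_EFinP/measurable_funTS.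
    exact: measurable_normal_pdf.
  - by move=> z _; rewrite patchE; case: ifP => // _; rewrite lee_fin normal_pdf_ge0.
  - by rewrite lee_fin normal_pdf_ge0.
  apply: eq_integral => z _; rewrite /F/= patchE indicE.
  case: ifP => _; last by rewrite !mul0e.
  by rewrite mul1e -!EFinM normal_pdf_mul.
rewrite fubini_tonelli//; last first.
  by move=> u; rewrite /F !mule_ge0// lee_fin ?normal_pdf_ge0.
rewrite [RHS]/normal_prob [RHS]integral_mkcond; apply: eq_integral => z _.
rewrite patchE /F/= indicE.
under eq_integral do rewrite muleA.
rewrite ge0_integralZl//; last 3 first.
- by apply/measurable_EFinP; exact: measurable_normal_pdf.
- by move=> y _; rewrite lee_fin normal_pdf_ge0.
- by rewrite mule_ge0// lee_fin ?normal_pdf_ge0.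
rewrite integral_normal_pdf mule1.
by case: ifP => _; rewrite ?mul1e ?mul0e.
Qed.

(** By uniqueness of product measures, the hypothesis on rectangles makes the joint law of [(g, f)]
    under [P] restricted to [W] a product of Gaussian measures scaled by [P W]; the convolution
    formula then applies. *)
Lemma probability_lincomb2 (R : realType) (d : measure_display)
    (T : measurableType d) (P : probability T R) (f g : T -> R) (W : set T)
    (s v a : R) : 0 < s -> 0 < v ->
  measurable_fun setT f -> measurable_fun setT g -> measurable W ->
  (forall A D : set R, measurable A -> measurable D ->
    P (f @^-1` A `&` (g @^-1` D `&` W)) =
      (normal_prob 0 v A * (normal_prob 0 s D * P W))%E) ->
  forall A : set R, measurable A ->
  P ((fun w => f w + a * g w) @^-1` A `&` W) =
    (normal_prob 0 (Num.sqrt (v ^+ 2 + a ^+ 2 * s ^+ 2)) A * P W)%E.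
Proof.
move=> s0 v0 mf mg mW PfgW A mA.
(* The mass [P W] is absorbed into the first Gaussian factor, so that the restricted law is a
   genuine product measure. *)
pose k : {nonneg R} := NngNum (fine_ge0 (measure_ge0 P W)).
have kE : k%:num%:E = P W by rewrite /= fineK// fin_num_measure.
pose h : T -> measurableTypeR R * measurableTypeR R := fun w => (g w, f w).
have mh : measurable_fun setT h by exact: measurable_fun_pair.
have mX : measurable [set z : R * R | A (z.2 + a * z.1)].
  rewrite -[X in measurable X]setTI.
  suff : measurable_fun setT (fun z : R * R => z.2 + a * z.1) by exact.
  by apply: measurable_funD => //; apply: measurable_funM.
rewrite -normal_prob_convolution// muleC -kE.
pose m1 : {sigma_finite_measure set (measurableTypeR R) -> \bar R} := mscale k (normal_prob 0 s).
transitivity ((m1 \x normal_prob 0 v)%E [set z : R * R | A (z.2 + a * z.1)]);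
    last first.
  rewrite /product_measure1 /m1 ge0_integral_mscale//.
  exact: measurable_fun_xsection.
apply/esym; transitivity (pushforward (mrestr P mW) h
  [set z : R * R | A (z.2 + a * z.1)]) => //.
apply: product_measure_unique => // D A' mD mA' /=.
rewrite /pushforward /mrestr /m1 /= /mscale kE.
rewrite [RHS]muleC (muleC (P W)) -PfgW//; congr (P _).
by apply/seteqP; split => w /=; tauto.
Qed.

(** The index [j] is unconstrained in the intersection, so [D] can be inserted there and the product
    formula used before and after. *)
Lemma noise_independent1 (R : realType) (d : measure_display)
    (T : measurableType d) (P : probability T R) (n : nat) (sigma : R)
    (eps : 'I_n -> {RV P >-> R}) (C : 'I_n -> set R) (j : 'I_n) (D : set R) :
  gaussian_noise P sigma eps -> (forall i, measurable (C i)) -> C j = setT ->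
  measurable D ->
  P (eps j @^-1` D `&` \bigcap_(i in [set: 'I_n]) (eps i @^-1` C i)) =
  (normal_prob 0 sigma D * P (\bigcap_(i in [set: 'I_n]) (eps i @^-1` C i)))%E.
Proof.
move=> [lawN indep] mC Cj mD.
pose C' i := if i == j then D else C i.
have mC' i : measurable (C' i) by rewrite /C'; case: ifP.
have -> : eps j @^-1` D `&` \bigcap_(i in [set: 'I_n]) (eps i @^-1` C i) =
    \bigcap_(i in [set: 'I_n]) (eps i @^-1` C' i).
  apply/seteqP; split => [w [Dw Cw] i _|w Cw].
    by rewrite /C'; case: eqP => [->//|_]; exact: Cw.
  split; first by have := Cw j I; rewrite /C' eqxx.
  move=> i _; have := Cw i I; rewrite /C'; case: eqP => [-> _|//].
  by rewrite Cj.
rewrite !indep// (bigD1 j)//= [in RHS](bigD1 j)//= Cj preimage_setT.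
rewrite probability_setT mul1e {1}/C' eqxx lawN//; congr (_ * _)%E.
by apply: eq_bigr => i /negbTE ij; rewrite /C' ij.
Qed.

(* The coefficient of [eps i0] is 1 so that the partial sums are never degenerate;
   the event [W] carries the independence from the variables not yet summed. *)
Lemma noise_lincomb_law (R : realType) (d : measure_display)
    (T : measurableType d) (P : probability T R) (n : nat) (sigma : R)
    (eps : 'I_n -> {RV P >-> R}) (a : 'I_n -> R) (i0 : 'I_n) (r : seq 'I_n) :
  0 < sigma -> gaussian_noise P sigma eps -> uniq (i0 :: r) ->
  forall (B : 'I_n -> set R) (A : set R),
  (forall i, measurable (B i)) -> measurable A ->
  let W := \bigcap_(i in [set: 'I_n])
             (eps i @^-1` (if i \in i0 :: r then setT else B i)) in
  P ((fun w => eps i0 w + \sum_(i <- r) a i * eps i w) @^-1` A `&` W) =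
  (normal_prob 0 (sigma * Num.sqrt (1 + \sum_(i <- r) a i ^+ 2)) A * P W)%E.
Proof.
move=> s0 noise; elim: r => [_ B A mB mA W|j r IH ujr B A mB mA W].
  rewrite big_nil addr0 sqrtr1 mulr1 -(noise_independent1 (j := i0) noise)//.
  - by congr (P (_ `&` _)); apply/seteqP; split => w /=; rewrite big_nil addr0.
  - by move=> i; case: ifP.
  - by rewrite inE eqxx.
have := ujr; rewrite /= inE negb_or -andbA => /and4P[i0j i0r jr ur].
have mW : measurable W.
  apply: fin_bigcap_measurable => // i _; apply: measurable_sfunP.
  by case: ifP.
have s1 : 0 < 1 + \sum_(i <- r) a i ^+ 2.
  by rewrite ltr_pwDl// sumr_ge0// => i _; exact: sqr_ge0.
have -> : sigma * Num.sqrt (1 + \sum_(i <- j :: r) a i ^+ 2) =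
    Num.sqrt ((sigma * Num.sqrt (1 + \sum_(i <- r) a i ^+ 2)) ^+ 2 +
              a j ^+ 2 * sigma ^+ 2).
  rewrite big_cons exprMn sqr_sqrtr ?ltW// -[in LHS](ger0_norm (ltW s0)) -sqrtr_sqr.
  by rewrite -sqrtrM ?sqr_ge0//; congr Num.sqrt; ring.
rewrite -(@probability_lincomb2 _ _ _ P
   (fun w => eps i0 w + \sum_(i <- r) a i * eps i w) (eps j) W sigma)//.
- congr (P (_ `&` _)); apply/seteqP; split => w /=.
    by rewrite big_cons addrCA addrC.
  by rewrite big_cons addrCA addrC.
- by rewrite mulr_gt0// sqrtr_gt0.
- apply: measurable_funD => //; apply: measurable_sum => i.
  exact: measurable_funM.
- move=> A' D mA' mD.
  (* The event on [eps j] is absorbed into the constraints: [j] is not yet summed in the sum over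
     [r], so the induction hypothesis applies with [B'] in place of [B]. *)
  pose B' i := if i == j then D else B i.
  rewrite -(noise_independent1 (j := j) noise)//; last 2 first.
  + by move=> i; case: ifP.
  + by rewrite !inE eqxx orbT.
  have -> : eps j @^-1` D `&` W = \bigcap_(i in [set: 'I_n])
             (eps i @^-1` (if i \in i0 :: r then setT else B' i)).
    apply/seteqP; split => [w [Dw Ww] i _|w Ww].
      have := Ww i I; rewrite /B' !inE; case: eqP => //= _.
      case: eqP => [->|_]; last by [].
      by rewrite (negbTE jr).
    split.
      have := Ww j I; rewrite /B' !inE eq_sym (negbTE i0j) (negbTE jr)/=.
      by rewrite eqxx.
    move=> i _; have := Ww i I; rewrite /B' !inE; case: (i == i0) => //=.
    by case: eqP => [->|_]//; rewrite (negbTE jr).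
  apply: IH => //.
  + by rewrite /= i0r.
  + by move=> i; rewrite /B'; case: ifP.
Qed.

(** * Gaussian tail bounds *)

(** Mills' ratio: on [[t, +oo[] the density is at most [x / t] times itself, which has an explicit
    antiderivative; symmetry doubles the one-sided bound. *)
Lemma normal_prob_tail (R : realType) (s t : R) : 0 < s -> 0 < t ->
  (normal_prob 0 s [set x | (t < `|x|)%R] <=
   (Num.sqrt (2 / pi) * (s / t) * expR (- (t ^+ 2 / (2 * s ^+ 2))))%:E)%E.
Proof.
move=> s0 t0.
have s_neq0 : s != 0 by rewrite gt_eqF.
pose g : R -> R := normal_pdf 0 s.
have gE : g = fun x => normal_peak s * expR (x ^+ 2 * - (s ^+ 2 *+ 2)^-1).
  apply/funext => x; rewrite /g normal_pdfE// /normal_fun subr0.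
  by rewrite mulNr mulrN.
(* An antiderivative of [x / t * g x] that vanishes at [+oo], so the right tail is at most
   [- F t]. *)
pose F : R -> R := fun x => - (s ^+ 2 / t) * g x.
have dF (x : R) : is_derive x (1 : R) F (x / t * g x).
  rewrite /F gE.
  have dexp : is_derive x (1 : R) (expR \o (fun x : R => x ^+ 2 * - (s ^+ 2 *+ 2)^-1))
      (expR (x ^+ 2 * - (s ^+ 2 *+ 2)^-1) * (- (s ^+ 2)^-1 * x)).
    apply: is_derive1_comp.
    apply: is_derive_eq; rewrite /GRing.scale/=.
    by rewrite mulr0 add0r !mulr1; field.
  have dg := is_deriveZ (- (s ^+ 2 / t)) (is_deriveZ (normal_peak s) dexp).
  apply: (is_derive_eq dg); rewrite /GRing.scale/=.
  by field; rewrite s_neq0 gt_eqF.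
have cg : continuous g by exact: continuous_normal_pdf.
have Foo : F x @[x --> +oo] --> (0 : R).
  rewrite /F -(mulr0 (- (s ^+ 2 / t))); apply: cvgM; first exact: cvg_cst.
  rewrite gE -(mulr0 (normal_peak s)); apply: cvgM; first exact: cvg_cst.
  under eq_fun do rewrite mulrN.
  apply: (cvg_comp (fun x : R => x ^+ 2 / (s ^+ 2 *+ 2)) (fun x => expR (- x)));
    last exact: cvgr_expR.
  apply: gt0_cvgMly; last exact: cvgr_expr2.
  by rewrite invr_gt0 pmulrn_lgt0// exprn_gt0.
have half : (\int[lebesgue_measure]_(x in `[t, +oo[) (g x)%:E <=
    (s ^+ 2 / t * g t)%:E)%E.
  have -> : (s ^+ 2 / t * g t)%:E = (0%:E - (F t)%:E)%E.
    by rewrite -EFinB sub0r /F mulNr opprK.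
  rewrite -(@ge0_continuous_FTC2y _ (fun x => x / t * g x) F t 0)//.
  - apply: ge0_le_integral => //=.
    + by move=> x _; rewrite lee_fin normal_pdf_ge0.
    + by apply/measurable_EFinP/measurable_funTS; exact: measurable_normal_pdf.
    + apply/measurable_EFinP/measurable_funTS; apply: measurable_funM.
        exact: measurable_funM.
      exact: measurable_normal_pdf.
    + move=> x; rewrite in_itv/= andbT => tx; rewrite lee_fin.
      by rewrite ler_peMl ?normal_pdf_ge0// ler_pdivlMr// mul1r.
  - move=> x tx; rewrite mulr_ge0 ?normal_pdf_ge0// divr_ge0// ?ltW//.
    exact: lt_le_trans tx.
  - apply: continuous_subspaceT => x; apply: cvgM; last exact: cg.
    by apply: cvgM; [exact: cvg_id|exact: cvg_cst].
  - apply: cvg_at_right_filter.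
    by apply: differentiable_continuous; apply/derivable1_diffP; have [] := dF t.
  - by move=> x _; rewrite derive1E; have [] := dF x.
have half' : (\int[lebesgue_measure]_(x in `]-oo, (- t)%R]) (g x)%:E =
    \int[lebesgue_measure]_(x in `[t, +oo[) (g x)%:E)%E.
  rewrite ge0_integration_by_substitutionNy//.
  - by apply: eq_integral => x _; rewrite gE/= sqrrN.
  - exact: continuous_subspaceT.
  - by move=> x _; exact: normal_pdf_ge0.
have sub : [set x : R | (t < `|x|)%R] `<=` `[t, +oo[%classic `|` `]-oo, (- t)%R]%classic.
  move=> x /=; rewrite !in_itv/= andbT ltr_normr => /orP[/ltW|]; first by left.
  by rewrite ltrNr => /ltW; right.
have mA : measurable [set x : R | (t < `|x|)%R].
  rewrite [X in measurable X](_ : _ = setT `&` Num.norm @^-1` `]t, +oo[%classic).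
    exact: normr_measurable.
  by rewrite setTI; apply/seteqP; split => x /=; rewrite in_itv/= andbT.
apply: (@le_trans _ _ (normal_prob 0 s `[t, +oo[%classic +
                       normal_prob 0 s `]-oo, (- t)%R]%classic)%E).
  apply: le_trans (measureU2 _ _ _) => //.
  by apply: le_measure => //; rewrite inE//; exact: measurableU.
rewrite {2}/normal_prob half' -[X in (_ + X)%E]/(normal_prob 0 s _).
apply: (le_trans (leeD half half)); rewrite -EFinD lee_fin gE /=.
rewrite (_ : t ^+ 2 * - (s ^+ 2 *+ 2)^-1 = - (t ^+ 2 / (2 * s ^+ 2))); last first.
  by field.
rewrite mulrA -mulrDl ler_pM2r ?expR_gt0//.
have -> : normal_peak s = (s * Num.sqrt (pi *+ 2))^-1.
  by rewrite /normal_peak -mulrnAr sqrtrM ?sqr_ge0// sqrtr_sqr gtr0_norm.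
have q0 : 0 < Num.sqrt (pi *+ 2 : R) by rewrite sqrtr_gt0 pmulrn_lgt0// pi_gt0.
(* The numerator 2 counts the two tails; the denominator comes from the peak of the density. *)
have -> : Num.sqrt (2 / pi) = 2 / Num.sqrt (pi *+ 2) :> R.
  have a2 : Num.sqrt 2 ^+ 2 = 2 :> R by rewrite sqr_sqrtr.
  rewrite -[pi *+ 2]mulr_natr sqrtrM ?pi_ge0// sqrtrM ?pi_ge0// sqrtrV ?pi_ge0//.
  rewrite -[X in _ = X / _]a2; field.
  by rewrite !gt_eqF ?sqrtr_gt0 ?pi_gt0.
rewrite le_eqVlt; apply/orP; left; apply/eqP; field.
by rewrite s_neq0 !gt_eqF.
Qed.

Lemma measurable_noise_lincomb (R : realType) (d : measure_display)
    (T : measurableType d) (P : probability T R) (n : nat)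
    (eps : 'I_n -> {RV P >-> R}) (b : 'I_n -> R) (t : R) :
  measurable [set w | t < `|\sum_i b i * eps i w|].
Proof.
have mf : measurable_fun setT (fun w => `|\sum_i b i * eps i w|).
  apply: measurableT_comp => //; apply: measurable_sum => i.
  exact: measurable_funM.
rewrite [X in measurable X](_ : _ = setT `&`
  (fun w => `|\sum_i b i * eps i w|) @^-1` `]t, +oo[%classic).
  exact: mf.
by rewrite setTI; apply/seteqP; split => x /=; rewrite in_itv/= andbT.
Qed.

(** Dividing by a nonzero coefficient [b i0] gives the normalized sum of [noise_lincomb_law].
    Threshold and standard deviation are both divided by the modulus of [b i0], so the tail bound
    does not change. *)
Lemma noise_lincomb_tail (R : realType) (d : measure_display)
    (T : measurableType d) (P : probability T R) (n : nat) (sigma : R)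
    (eps : 'I_n -> {RV P >-> R}) (b : 'I_n -> R) (t : R) :
  0 < sigma -> gaussian_noise P sigma eps -> 0 < \sum_i b i ^+ 2 -> 0 < t ->
  (P [set w | (t < `|\sum_i b i * eps i w|)%R] <=
   (Num.sqrt (2 / pi) * (sigma * Num.sqrt (\sum_i b i ^+ 2) / t) *
    expR (- (t ^+ 2 / (2 * (sigma * Num.sqrt (\sum_i b i ^+ 2)) ^+ 2))))%:E)%E.
Proof.
move=> sigma0 noise V0 t0; set s := sigma * _.
have [i0 bi0] : exists i0, b i0 != 0.
  apply/existsP; rewrite -negb_forall; apply: contraTN V0 => /forallP b0.
  by rewrite big1 ?ltxx// => i _; have /eqP -> := b0 i; rewrite expr0n.
have nb0 : 0 < `|b i0| by rewrite normr_gt0.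
pose a i := b i / b i0.
pose r := [seq i <- index_enum 'I_n | i != i0].
have ur : uniq (i0 :: r).
  by rewrite /= mem_filter eqxx/= filter_uniq// index_enum_uniq.
pose A := [set x : R | t / `|b i0| < `|x|].
have mA : measurable A.
  rewrite /A [X in measurable X](_ : _ = setT `&` Num.norm @^-1` `]t / `|b i0|, +oo[%classic).
    exact: normr_measurable.
  by rewrite setTI; apply/seteqP; split => x /=; rewrite in_itv/= andbT.
have sumE w : \sum_i b i * eps i w =
    b i0 * (eps i0 w + \sum_(i <- r) a i * eps i w).
  rewrite (bigD1 i0)//= mulrDr mulr_sumr /r big_filter; congr (_ + _).
  by apply: eq_bigr => i _; rewrite /a mulrA mulrCA divff// mulr1.
have sE : s / `|b i0| = sigma * Num.sqrt (1 + \sum_(i <- r) a i ^+ 2).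
  rewrite /s -sqrtr_sqr -mulrA -sqrtrV ?sqr_ge0// -sqrtrM ?ltW//.
  congr (_ * Num.sqrt _); rewrite (bigD1 i0)//= mulrDl divff ?sqrf_eq0//.
  congr (_ + _); rewrite mulr_suml /r big_filter.
  by apply: eq_bigr => i _; rewrite /a expr_div_n.
have := @noise_lincomb_law _ _ _ P n sigma eps a i0 r sigma0 noise ur
  (fun=> setT) A (fun=> measurableT) mA.
have -> : \bigcap_(i in [set: 'I_n])
    (eps i @^-1` (if i \in i0 :: r then setT else setT)) = setT.
  by apply/seteqP; split => // w _ i _; case: ifP.
rewrite /= setIT probability_setT mule1 -sE.
rewrite (_ : _ @^-1` A = [set w | t < `|\sum_i b i * eps i w|]); last first.
  by rewrite /A; apply/seteqP; split => w /=; rewrite sumE normrM ltr_pdivrMr// mulrC.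
move=> ->.
have s0 : 0 < s by rewrite mulr_gt0// sqrtr_gt0.
have := @normal_prob_tail _ (s / `|b i0|) (t / `|b i0|) (divr_gt0 s0 nb0) (divr_gt0 t0 nb0).
move=> /le_trans; apply; rewrite lee_fin le_eqVlt; apply/orP; left; apply/eqP.
congr (_ * _ * expR (- _)).
  by field; rewrite !gt_eqF.
by field; rewrite !gt_eqF.
Qed.

(** The standard deviation is [sigma * sqrt n], so [n] cancels in the exponent and a power of [m]
    remains. It serves with [m = pt] for all columns and with [m = n] for those of the true
    support. *)
Lemma noise_column_tail (R : realType) (d : measure_display)
    (T : measurableType d) (P : probability T R) (n : nat) (sigma : R)
    (eps : 'I_n -> {RV P >-> R}) (b : 'I_n -> R) (C m : R) :
  0 < sigma -> gaussian_noise P sigma eps -> (0 < n)%N ->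
  \sum_i b i ^+ 2 = n%:R -> 0 < C -> 1 < m ->
  (P [set w | (C * Num.sqrt (n%:R * ln m) < `|\sum_i b i * eps i w|)%R] <=
   (Num.sqrt (2 / pi) * C^-1 * sigma * powR (ln m) (- 2^-1) *
    powR m (- (C ^+ 2 / (2 * sigma ^+ 2))))%:E)%E.
Proof.
move=> sigma0 noise n0 bn C0 m1.
have nR0 : 0 < n%:R :> R by rewrite ltr0n.
have L0 : 0 < ln m by rewrite ln_gt0.
have sL0 : 0 < Num.sqrt (ln m) by rewrite sqrtr_gt0.
have sn0 : 0 < Num.sqrt (n%:R : R) by rewrite sqrtr_gt0.
have t0 : 0 < C * Num.sqrt (n%:R * ln m) by rewrite mulr_gt0// sqrtr_gt0 mulr_gt0.
have V0 : 0 < \sum_i b i ^+ 2 by rewrite bn.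
apply: (le_trans (noise_lincomb_tail sigma0 noise V0 t0)).
rewrite lee_fin le_eqVlt; apply/orP; left; apply/eqP.
rewrite bn (powRN (ln m)) powR12_sqrt ?ltW// [Num.sqrt (n%:R * _)]sqrtrM ?ler0n//.
rewrite /powR gt_eqF ?(lt_trans _ m1)//.
congr (_ * expR _); first by field; rewrite !gt_eqF.
rewrite !exprMn !sqr_sqrtr ?ltW//; field.
by rewrite !gt_eqF.
Qed.

(** * Union bound over the columns *)

Lemma probability_bigsetU_le (R : realType) (d : measure_display)
    (T : measurableType d) (P : probability T R) (I : finType) (Q : pred I)
    (F : I -> set T) : (forall i, measurable (F i)) ->
  measurable (\big[setU/set0]_(i | Q i) F i) /\
  (P (\big[setU/set0]_(i | Q i) F i) <= \sum_(i | Q i) P (F i))%E.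
Proof.
move=> mF; elim/big_rec2: _ => [|i u A _ [mA PA]]; first by rewrite measure0.
split; first exact: measurableU.
by apply: (le_trans (measureU2 _ _ _)) => //; rewrite leeD2l.
Qed.

(** The event is the complement of all exceedances at the two levels; [1 < n] makes both logarithms
    positive, as the tail bound requires. *)
Lemma noise_event (R : realType) (d : measure_display)
    (T : measurableType d) (P : probability T R) (n p : nat) (sigma c2 c2' : R)
    (X : 'M[R]_(n, p)) (S : {set 'I_p}) (eps : 'I_n -> {RV P >-> R}) :
  0 < sigma -> 0 < c2 -> 0 < c2' -> gaussian_noise P sigma eps -> (1 < n)%N ->
  (forall j : 'I_p, \sum_i (X i j) ^+ 2 = n%:R) ->
  let pt := (maxn n p)%:R : R in
  exists E : set T, [/\ measurable E,
    forall w, E w ->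
      (forall j, `|\sum_i X i j * eps i w| <= c2 * Num.sqrt (n%:R * ln pt)) /\
      (forall j, j \in S ->
        `|\sum_i X i j * eps i w| <= c2' * Num.sqrt (n%:R * ln n%:R)) &
    ((1 - Num.sqrt (2 / pi) * c2^-1 * sigma * powR (ln pt) (- 2^-1)
             * powR pt (1 - c2 ^+ 2 / (2 * sigma ^+ 2))
        - Num.sqrt (2 / pi) * c2'^-1 * sigma * #|S|%:R * powR (ln (n%:R : R)) (- 2^-1)
             * powR (n%:R : R) (- (c2' ^+ 2 / (2 * sigma ^+ 2))))%:E
     <= P E)%E].
Proof.
move=> sigma0 c20 c2'0 noise n1 Xn pt.
have n0 : (0 < n)%N by exact: ltnW.
have nR1 : 1 < n%:R :> R by rewrite ltr1n.
have pt1 : 1 < pt by rewrite ltr1n (leq_trans n1)// leq_maxl.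
have pt0 : 0 < pt := lt_trans ltr01 pt1.
pose F C m j := [set w | C * Num.sqrt (n%:R * ln m) < `|\sum_i X i j * eps i w|].
have mF C m j : measurable (F C m j) by exact: measurable_noise_lincomb.
pose U1 := \big[setU/set0]_(j < p) F c2 pt j.
pose U2 := \big[setU/set0]_(j in S) F c2' n%:R j.
have [mU1 PU1] : measurable U1 /\ (P U1 <= \sum_(j < p) P (F c2 pt j))%E.
  exact: probability_bigsetU_le.
have [mU2 PU2] : measurable U2 /\ (P U2 <= \sum_(j in S) P (F c2' n%:R j))%E.
  exact: probability_bigsetU_le.
have F1 j : F c2 pt j `<=` U1.
  by rewrite /U1 -bigcup_seq => w Fw; exists j => //=; rewrite mem_index_enum.
have F2 j : j \in S -> F c2' n%:R j `<=` U2.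
  move=> jS; rewrite /U2 -bigcup_seq_cond => w Fw; exists j => //=.
  by rewrite mem_index_enum.
exists (~` (U1 `|` U2)); split.
- by apply: measurableC; exact: measurableU.
- move=> w /not_orP[nU1 nU2]; split => [j|j jS]; rewrite leNgt; apply/negP => ?.
    by apply: nU1; exact: (F1 j).
  by apply: nU2; exact: (F2 j).
rewrite probability_setC; last exact: measurableU.
have -> : Num.sqrt (2 / pi) * c2'^-1 * sigma * #|S|%:R * powR (ln (n%:R : R)) (- 2^-1)
     * powR (n%:R : R) (- (c2' ^+ 2 / (2 * sigma ^+ 2))) =
   (Num.sqrt (2 / pi) * c2'^-1 * sigma * powR (ln (n%:R : R)) (- 2^-1)
     * powR (n%:R : R) (- (c2' ^+ 2 / (2 * sigma ^+ 2)))) *+ #|S|.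
  by rewrite -[RHS]mulr_natr; ring.
set q2 := _ *+ #|S|.
set q1 := _ * powR pt _.
rewrite -addrA -opprD EFinB leeB//.
apply: (le_trans (measureU2 _ _ _)) => //; rewrite EFinD leeD//.
- apply: (le_trans PU1).
  pose x := Num.sqrt (2 / pi) * c2^-1 * sigma * powR (ln pt) (- 2^-1) *
             powR pt (- (c2 ^+ 2 / (2 * sigma ^+ 2))).
  apply: (@le_trans _ _ (\sum_(i < p) x%:E)%E).
    by apply: lee_sum => j _; exact: noise_column_tail.
  rewrite sumEFin lee_fin sumr_const card_ord -mulr_natr.
  (* The [p] equal terms are absorbed by [p <= pt], which accounts for the 1 in the exponent of
     [pt]. *)
  rewrite /q1 powRD; last by rewrite (gt_eqF pt0) implybT.
  rewrite (powRr1 (ltW pt0)) [leRHS]mulrCA [leRHS]mulrC /x.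
  apply: ler_wpM2l; last by rewrite ler_nat leq_maxr.
  by rewrite !mulr_ge0 ?powR_ge0 ?sqrtr_ge0 ?invr_ge0 ?(ltW c20) ?(ltW sigma0).
- apply: (le_trans PU2); rewrite /q2.
  rewrite -sumr_const -sumEFin; apply: lee_sum => j _.
  exact: noise_column_tail.
Qed.

(** * Sparse vectors and the robust spark *)

Section Norms.
Variable R : realType.

Lemma l2norm_ge0 m (v : 'cV[R]_m) : 0 <= l2norm v.
Proof. exact: sqrtr_ge0. Qed.

Lemma sqr_l2norm m (v : 'cV[R]_m) : l2norm v ^+ 2 = \sum_i v i 0 ^+ 2.
Proof. by rewrite sqr_sqrtr// sumr_ge0// => i _; exact: sqr_ge0. Qed.

Lemma l2normZ m (a : R) (v : 'cV[R]_m) : l2norm (a *: v) = `|a| * l2norm v.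
Proof.
rewrite /l2norm -sqrtr_sqr -sqrtrM ?sqr_ge0// mulr_sumr.
by congr Num.sqrt; apply: eq_bigr => i _; rewrite mxE exprMn.
Qed.

Lemma normr_le_l2norm m (v : 'cV[R]_m) i : `|v i 0| <= l2norm v.
Proof.
rewrite -sqrtr_sqr ler_wsqrtr// (bigD1 i)//= lerDl sumr_ge0// => j _.
exact: sqr_ge0.
Qed.

Lemma l2norm_gt0 m (v : 'cV[R]_m) i : v i 0 != 0 -> 0 < l2norm v.
Proof.
by move=> vi; apply: lt_le_trans (normr_le_l2norm v i); rewrite normr_gt0.
Qed.

Lemma linfnorm_le_l2norm m (v : 'cV[R]_m) : linfnorm v <= l2norm v.
Proof. by apply/bigmax_leP; split=> [|i _]; [exact: l2norm_ge0|exact: normr_le_l2norm]. Qed.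

Lemma in_supp p (b : 'cV[R]_p) j : (j \in supp b) = (b j 0 != 0).
Proof. by rewrite inE. Qed.

Lemma l2norm_supp m (v : 'cV[R]_m) : l2norm v ^+ 2 = \sum_(i in supp v) `|v i 0| ^+ 2.
Proof.
rewrite sqr_l2norm [RHS]big_mkcond; apply: eq_bigr => i _.
by rewrite in_supp; case: eqP => [->|_]/=; rewrite ?expr0n// real_normK ?num_real.
Qed.

(** Convexity of [expR] between [ln x] and 0 with weight [r]. The point [x = 0] is treated apart,
    with [powR 0 0] equal to 1. *)
Lemma powR_Bernoulli (x r : R) : 0 <= x -> 0 <= r -> r <= 1 ->
  x `^ r <= 1 + r * (x - 1).
Proof.
move=> x0 r0 r1; have [->|xn0] := eqVneq x 0.
  rewrite /powR eqxx; case: eqP => [->|_]/=; first by lra.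
  by lra.
have xp : 0 < x by rewrite lt_def xn0.
rewrite /powR (negbTE xn0).
have := @convex_expR R (Itv01 r0 r1) (ln x) 0.
rewrite !convRE/= expR0 lnK ?posrE//= mulr0 addr0 => /le_trans; apply.
by rewrite /unstable.onem; lra.
Qed.

(** The power-mean inequality on the support, multiplied out so that it also covers the zero
    vector. *)
Lemma lqnorm_le_l2norm m (v : 'cV[R]_m) (q : R) : 1 <= q -> q <= 2 ->
  lqnorm q v * Num.sqrt (l0 v)%:R <= (l0 v)%:R `^ q^-1 * l2norm v.
Proof.
move=> q1 q2; have q0 : 0 < q by exact: lt_le_trans q1.
have [S0|[i0 iS]] := set_0Vmem (supp v).
  by rewrite /l0 S0 cards0 sqrtr0 mulr0 mulr_ge0// ?powR_ge0// l2norm_ge0.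
set N := l2norm v; set s : R := (l0 v)%:R.
have N0 : 0 < N by apply: (@l2norm_gt0 _ _ i0); rewrite -in_supp.
have s0 : 0 < s by rewrite ltr0n; apply/card_gt0P; exists i0.
have ss0 : 0 < Num.sqrt s by rewrite sqrtr_gt0.
(* With this scaling the squares average 1 over the support. Summing Bernoulli's inequality with
   exponent [q / 2 <= 1], the linear terms cancel. *)
pose u i := `|v i 0| * (Num.sqrt s / N).
have u0 i : 0 <= u i by rewrite mulr_ge0// divr_ge0// ltW.
have u2 : \sum_(i in supp v) u i ^+ 2 = s.
  under eq_bigr do rewrite /u exprMn.
  rewrite -mulr_suml -l2norm_supp -/N expr_div_n (sqr_sqrtr (ltW s0)).
  by field; rewrite gt_eqF.
have uq : \sum_(i in supp v) u i `^ q <= s.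
  apply: (@le_trans _ _ (\sum_(i in supp v) (1 + q / 2 * (u i ^+ 2 - 1)))).
    apply: ler_sum => i _.
    have -> : q = 2 * (q / 2) by field.
    rewrite powRrM (powR_mulrn 2)//.
    by rewrite (_ : 2 * (q / 2) / 2 = q / 2); [apply: powR_Bernoulli; rewrite ?sqr_ge0//; lra|field].
  rewrite big_split/= -mulr_sumr sumrB u2 sumr_const -/(l0 v) -/s.
  by rewrite subrr mulr0 addr0.
have vq : \sum_i `|v i 0| `^ q = (N / Num.sqrt s) `^ q * \sum_(i in supp v) u i `^ q.
  rewrite mulr_sumr [RHS]big_mkcond; apply: eq_bigr => i _.
  rewrite in_supp; case: eqP => [->|_] /=.
    by rewrite normr0 powR0// gt_eqF.
  rewrite -powRM//; last by rewrite divr_ge0// ltW.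
  by congr powR; rewrite /u; field; rewrite !gt_eqF.
have NS : 0 <= N / Num.sqrt s by rewrite divr_ge0// ltW.
rewrite /lqnorm vq powRM ?powR_ge0 ?sumr_ge0//; last by move=> *; exact: powR_ge0.
rewrite -powRrM divff ?gt_eqF// powRr1// mulrAC divfK ?gt_eqF// mulrC.
apply: ler_wpM2r; first exact: ltW.
apply: ge0_ler_powR; rewrite ?invr_ge0 ?nnegrE ?(ltW q0) ?(ltW s0)//.
by rewrite sumr_ge0// => *; exact: powR_ge0.
Qed.

Lemma l1norm_le_l2norm m (v : 'cV[R]_m) :
  \sum_i `|v i 0| <= Num.sqrt (l0 v)%:R * l2norm v.
Proof.
have [S0|[i0 iS]] := set_0Vmem (supp v).
  rewrite big1 ?mulr_ge0 ?sqrtr_ge0// => i _.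
  by apply/eqP; rewrite normr_eq0 -[_ == 0]negbK -in_supp S0 inE.
have s0 : 0 < (l0 v)%:R :> R by rewrite ltr0n; apply/card_gt0P; exists i0.
have := @lqnorm_le_l2norm _ v 1 (lexx _) (ler1n _ 2).
rewrite /lqnorm invr1 !powRr1; last 2 first.
- exact: ltW.
- by rewrite sumr_ge0// => *; exact: powR_ge0.
under eq_bigr do rewrite powRr1//.
rewrite -{2}(sqr_sqrtr (ltW s0)) expr2 -mulrA [X in _ <= X]mulrC ler_pM2r ?sqrtr_gt0//.
Qed.

End Norms.

Section Sparsity.
Variables (R : realType) (n p : nat).
Implicit Types (X : 'M[R]_(n, p)) (b v : 'cV[R]_p).

(** The value 0 is vacuously admissible, and the larger of two admissible values is one of them, so
    the maximum is itself admissible. *)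
Lemma rspark_okP (c : R) X : rspark_ok c X (rspark c X).
Proof.
rewrite /rspark; elim/big_ind: _ => [|a b ha hb|i /asboolP//]; first by move=> ?.
by rewrite /maxn; case: ifP.
Qed.

(** By homogeneity: rescaling to unit length preserves the support. *)
Lemma rspark_lower_bound (c : R) X v : (l0 v < rspark c X)%N ->
  c * l2norm v <= (Num.sqrt n%:R)^-1 * l2norm (X *m v).
Proof.
move=> vM; have [N0|N0] := eqVneq (l2norm v) 0.
  by rewrite N0 mulr0 mulr_ge0 ?invr_ge0 ?sqrtr_ge0.
have Np : 0 < l2norm v by rewrite lt_def N0 sqrtr_ge0.
have := @rspark_okP c X ((l2norm v)^-1 *: v).
rewrite -scalemxAr !l2normZ ger0_norm ?invr_ge0 ?(ltW Np)// mulVf//.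
rewrite mulrCA [(l2norm v)^-1 * _]mulrC ler_pdivlMr//; apply=> //.
suff -> : l0 ((l2norm v)^-1 *: v) = l0 v by [].
by apply: eq_card => j; rewrite !in_supp mxE mulf_eq0 invr_eq0 (negbTE N0).
Qed.

Lemma l0_sub v b : (l0 (v - b) <= l0 v + l0 b)%N.
Proof.
apply: leq_trans (leq_card_setU _ _); apply: subset_leq_card; apply/fintype.subsetP => j.
rewrite !inE !mxE; apply: contraR; rewrite negb_or !negbK.
by move=> /andP[/eqP-> /eqP->]; rewrite subr0.
Qed.

(** With at most one row, any two columns are linearly dependent, so some nonzero vector with at
    most two nonzero entries is in the kernel. This settles [n <= 1], where [ln n] is not
    positive. *)
Lemma rspark_le2 (c : R) X : 0 < c -> (n <= 1)%N -> (rspark c X <= 2)%N.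
Proof.
move=> c0 n1; rewrite leqNgt; apply/negP => M3.
(* The maximum ranges over values up to [p + 1], so a robust spark of at least 3 leaves two columns
   to choose. *)
have p2 : (1 < p)%N.
  have : (rspark c X <= p.+1)%N.
    by apply/bigmax_leqP => i _; rewrite -ltnS.
  by move=> /(leq_trans M3).
pose j0 := Ordinal (ltnW p2); pose j1 := Ordinal p2.
have [v [v0 lv Xv]] : exists v : 'cV[R]_p,
    [/\ exists j, v j 0 != 0, (l0 v <= 2)%N & X *m v = 0].
  have key (a b : R) : (a != 0) || (b != 0) -> (forall i, X i j0 * a + X i j1 * b = 0) ->
    exists v : 'cV[R]_p,
    [/\ exists j, v j 0 != 0, (l0 v <= 2)%N & X *m v = 0].
    move=> ab Xab; pose v : 'cV[R]_p := \col_j (if j == j0 then a else if j == j1 then b else 0).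
    exists v; split.
    - by case/orP: ab => ?; [exists j0|exists j1]; rewrite mxE.
    - have : supp v \subset [set j0; j1]%SET.
        apply/fintype.subsetP => j; rewrite in_supp mxE !inE.
        by case: (j == j0) => //; case: (j == j1) => //; rewrite eqxx.
      by move=> /subset_leq_card /leq_trans; apply; rewrite cards2 ltnS leq_b1.
    - apply/colP => i; rewrite !mxE (bigD1 j0)//= (bigD1 j1)//= big1 ?addr0.
        by rewrite !mxE/= Xab.
      by move=> j /andP[/negbTE jj0 /negbTE jj1]; rewrite mxE jj0 jj1 mulr0.
  case: n X n1 {M3} key => [|[|//]] X _ key.
    by apply: (key 1 0); rewrite ?oner_eq0// => -[].
  have [x0|x0] := eqVneq (X 0 j0) 0.
    apply: (key 1 0); rewrite ?oner_eq0// => i.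
    by rewrite ord1 x0; ring.
  apply: (key (- X 0 j1) (X 0 j0)); first by rewrite x0 orbT.
  by move=> i; rewrite ord1; ring.
case: v0 => j vj.
have := rspark_lower_bound (leq_ltn_trans lv M3).
rewrite Xv (_ : l2norm 0 = 0); last first.
  by rewrite /l2norm big1 ?sqrtr0// => i _; rewrite mxE expr0n.
rewrite mulr0 leNgt mulr_gt0//; exact: (l2norm_gt0 vj).
Qed.

End Sparsity.

(** * Penalized least squares *)

Section Objective.
Variable R : realType.
Implicit Types (k : penalty_kind) (lam : R).

Lemma pen0 k lam : 0 <= lam -> pen k lam 0 = 0.
Proof.
move=> l0; case: k => /=; last by rewrite eqxx.
by rewrite subr0 (max_idPl l0) subrr mul0r.
Qed.

Lemma pen_ge_lam k lam (t : R) : 0 < lam -> lam <= t -> pen k lam t = lam ^+ 2 / 2.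
Proof.
move=> l0 lt; case: k => /=.
  by rewrite (max_idPr _) ?subr_le0// expr0n/= subr0.
by rewrite gt_eqF// (lt_le_trans l0).
Qed.

(* With the hard-thresholding penalty the objective is constant on the segment
   [0, lam] when [|z| = lam], so a minimizer may lie strictly below [lam]; both
   ends of the segment are then minimizers as well. *)
Lemma scalar_threshold k lam (z b : R) : 0 < lam -> b != 0 ->
  (forall v, (b - z) ^+ 2 / 2 + pen k lam `|b| <= (v - z) ^+ 2 / 2 + pen k lam `|v|) ->
  lam <= `|b| \/
  forall a, a = 0 \/ a = Num.sg b * lam ->
    (a - z) ^+ 2 / 2 + pen k lam `|a| <= (b - z) ^+ 2 / 2 + pen k lam `|b|.
Proof.
move=> lam0 b0 bmin; have [?|blam] := leP lam `|b|; [by left|right].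
have nb0 : 0 < `|b| by rewrite normr_gt0.
have bE : b = Num.sg b * `|b| by rewrite -numEsg.
have sg2 : Num.sg b ^+ 2 = 1 by rewrite sqr_sg b0.
have nsg : `|Num.sg b * lam| = lam by rewrite normrM normr_sg b0 mul1r gtr0_norm.
have h0 := bmin 0; have hl := bmin (Num.sg b * lam); have hz := bmin z.
rewrite nsg (pen_ge_lam k lam0 (lexx lam)) in hl; rewrite normr0 pen0 ?(ltW lam0)// in h0.
case: k {bmin} h0 hl hz => /= h0 hl hz a aE.
  rewrite (max_idPl _) ?subr_ge0 ?(ltW blam)// in h0 hl *.
  move: bE sg2 nb0 blam h0 hl aE nsg {hz b0}.
  move: (Num.sg b) (`|b|) => s u -> s2 u0 ul h0 hl aE nsg.
  have e1 : (s * u - z) ^+ 2 = u ^+ 2 - 2 * (s * z) * u + z ^+ 2.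
    by rewrite (_ : u ^+ 2 = s ^+ 2 * u ^+ 2); [ring|rewrite s2 mul1r].
  have e2 : (s * lam - z) ^+ 2 = lam ^+ 2 - 2 * (s * z) * lam + z ^+ 2.
    by rewrite (_ : lam ^+ 2 = s ^+ 2 * lam ^+ 2); [ring|rewrite s2 mul1r].
  rewrite e1 in h0 hl *; rewrite e2 in hl.
  (* For [u] between 0 and [lam] the quadratic terms cancel, and the objective is affine in [u] with
     slope [lam - s * z]. Comparison with the two ends forces this slope to be 0. *)
  have g1 : lam <= s * z by nra.
  have g2 : s * z <= lam by nra.
  have sz : s * z = lam by lra.
  case: aE => ->.
    by rewrite normr0 subr0 (max_idPl (ltW lam0)) sz; lra.
  by rewrite nsg e2 subrr maxxx expr0n/= sz; lra.
rewrite (gt_eqF nb0)/= in h0 hl hz *.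
(* Under the L0 penalty every nonzero value costs the same, so the best one is [z]; being no worse
   than 0 then contradicts a modulus below [lam]. *)
have bz : b = z.
  have /eqP : (b - z) ^+ 2 = 0.
    apply/eqP; rewrite eq_le sqr_ge0 andbT; move: hz; rewrite subrr expr0n/=.
    have := sqr_ge0 lam; case: ifP => _; lra.
  by rewrite sqrf_eq0 subr_eq0 => /eqP.
exfalso; move: h0; rewrite -bz subrr expr0n/= sub0r sqrrN -(real_normK (num_real b)).
nra.
Qed.

Variables (n p : nat).
Implicit Types (X : 'M[R]_(n, p)) (y : 'cV[R]_n) (b : 'cV[R]_p).

Definition upd b (j : 'I_p) (v : R) : 'cV[R]_p :=
  \col_i (if i == j then v else b i 0).

Lemma upd_id b j : upd b j (b j 0) = b.
Proof. by apply/colP => i; rewrite mxE; case: eqP => [->|]. Qed.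

Lemma supp_upd_sub b j v : b j 0 != 0 -> supp (upd b j v) \subset supp b.
Proof.
move=> bj; apply/fintype.subsetP => i; rewrite !in_supp mxE.
by case: (i =P j) => [->|].
Qed.

(** The normalization of the columns makes the coefficient of [v ^+ 2] exactly 1/2, which gives the
    scalar problem of [scalar_threshold]. *)
Lemma Qobj_coord k lam X y b j : (0 < n)%N -> \sum_i X i j ^+ 2 = n%:R ->
  exists K z, forall v,
    Qobj k lam X y (upd b j v) = K + ((v - z) ^+ 2 / 2 + pen k lam `|v|).
Proof.
move=> n0 Xj; have nR : (n%:R : R) != 0 by rewrite pnatr_eq0 -lt0n.
pose r := y - X *m upd b j 0.
have rE v i : (y - X *m upd b j v) i 0 = r i 0 - v * X i j.
  have E u : (X *m upd b j u) i 0 = X i j * u + \sum_(l | l != j) X i l * b l 0.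
    rewrite mxE (bigD1 j)//= mxE eqxx; congr (_ + _).
    by apply: eq_bigr => l /negbTE lj; rewrite mxE lj.
  by rewrite mxE [in RHS]mxE mxE [in RHS]mxE !E; ring.
(* The least-squares value of the coordinate: column [j] against the residual computed without
   it. *)
pose z := n%:R^-1 * \sum_i r i 0 * X i j.
exists ((2 * n%:R)^-1 * (\sum_i r i 0 ^+ 2) - z ^+ 2 / 2 +
        \sum_(l | l != j) pen k lam `|b l 0|), z => v.
rewrite /Qobj sqr_l2norm [X in _ + X](bigD1 j)//= mxE eqxx.
rewrite [X in pen _ _ _ + X](eq_bigr (fun l => pen k lam `|b l 0|)); last first.
  by move=> l /negbTE lj; rewrite mxE lj.
under eq_bigr => i _ do rewrite rE sqrrB exprMn.
rewrite big_split sumrB/= -mulr_sumr Xj.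
have -> : \sum_i r i 0 * (v * X i j) *+ 2 = 2 * v * (n%:R * z).
  rewrite /z mulrA divff// mul1r mulr_sumr; apply: eq_bigr => i _; ring.
by field.
Qed.

End Objective.

(** * Support recovery and estimation error *)

(** Expanding the squares leaves one cross term, bounded columnwise by the noise level times the l1
    norm of the difference. Only columns in the support of the difference enter, so the finer noise
    level can be used once the supports agree. *)
Lemma basic_inequality (R : realType) (n p : nat) (k : penalty_kind) (lam A : R)
    (X : 'M[R]_(n, p)) (beta b : 'cV[R]_p) (e : 'cV[R]_n) : (0 < n)%N -> 0 <= A ->
  (forall j, j \in supp (b - beta) -> `|\sum_i X i j * e i 0| <= n%:R * A) ->
  Qobj k lam X (X *m beta + e) b <= Qobj k lam X (X *m beta + e) beta ->
  ((Num.sqrt n%:R)^-1 * l2norm (X *m (b - beta))) ^+ 2 / 2 +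
    \sum_j pen k lam `|b j 0| - \sum_j pen k lam `|beta j 0| <=
  A * (Num.sqrt (l0 (b - beta))%:R * l2norm (b - beta)).
Proof.
move=> n0 A0 noise; rewrite /Qobj; set pb := \sum_j _; set pbeta := \sum_j _.
have nR : 0 < n%:R :> R by rewrite ltr0n.
have -> : X *m beta + e - X *m b = e - X *m (b - beta).
  rewrite mulmxBr; move: (X *m beta) (X *m b) => u v.
  by apply/colP => i; rewrite !mxE; ring.
have -> : X *m beta + e - X *m beta = e by rewrite addrC addKr.
set dl := b - beta in noise *.
have -> : l2norm (e - X *m dl) ^+ 2 =
    l2norm e ^+ 2 - 2 * (\sum_i e i 0 * (X *m dl) i 0) + l2norm (X *m dl) ^+ 2.
  rewrite !sqr_l2norm mulr_sumr -sumrB -big_split/=; move: (X *m dl) => u.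
  by apply: eq_bigr => i _; rewrite !mxE; ring.
have cross : \sum_i e i 0 * (X *m dl) i 0 <=
    n%:R * A * (Num.sqrt (l0 dl)%:R * l2norm dl).
  have -> : \sum_i e i 0 * (X *m dl) i 0 = \sum_j dl j 0 * \sum_i X i j * e i 0.
    under eq_bigr do rewrite mxE mulr_sumr.
    rewrite exchange_big/=; apply: eq_bigr => j _; rewrite mulr_sumr.
    by apply: eq_bigr => i _; ring.
  apply: (@le_trans _ _ (n%:R * A * \sum_j `|dl j 0|)).
    rewrite mulr_sumr; apply: ler_sum => j _.
    have [->|dj] := eqVneq (dl j 0) 0; first by rewrite normr0 mulr0 mul0r.
    apply: (le_trans (ler_norm _)); rewrite normrM mulrC ler_wpM2r//.
    by apply: noise; rewrite in_supp.
  apply: ler_wpM2l; last exact: l1norm_le_l2norm.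
  by rewrite mulr_ge0// ltW.
rewrite exprMn exprVn (sqr_sqrtr (ler0n R n)).
move: cross; set I := \sum_i _; set E := l2norm e; set G := l2norm _; set D := _ * l2norm dl.
move=> cross Qb.
have key : (2 * n%:R)^-1 * (E ^+ 2 - 2 * I + G ^+ 2) - (2 * n%:R)^-1 * E ^+ 2 =
    n%:R^-1 * G ^+ 2 / 2 - n%:R^-1 * I by field; rewrite gt_eqF.
have : n%:R^-1 * I <= A * D by rewrite ler_pdivrMl// mulrA.
lra.
Qed.

Lemma sum_pen_ge_lam (R : realType) (p : nat) (k : penalty_kind) (lam : R)
    (b : 'cV[R]_p) : 0 < lam -> (forall j, j \in supp b -> lam <= `|b j 0|) ->
  \sum_j pen k lam `|b j 0| = (l0 b)%:R * (lam ^+ 2 / 2).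
Proof.
move=> lam0 bl; rewrite mulr_natl -sumr_const [RHS]big_mkcond/=.
apply: eq_bigr => j _; case: ifPn => [/bl|]; first exact: pen_ge_lam.
by rewrite in_supp negbK => /eqP ->; rewrite normr0 pen0 ?ltW.
Qed.

Lemma support_recovery (R : realType) (n p : nat) (k : penalty_kind)
    (c lam A : R) (X : 'M[R]_(n, p)) (beta b : 'cV[R]_p) (e : 'cV[R]_n) :
  (0 < n)%N -> 0 < c -> 0 < lam -> 0 <= A ->
  (2 * l0 beta < rspark c X)%N -> (2 * l0 b < rspark c X)%N ->
  (forall j, `|\sum_i X i j * e i 0| <= n%:R * A) ->
  A * Num.sqrt (2 * l0 beta + 1)%:R < c * lam ->
  (forall j, j \in supp beta ->
     [/\ lam <= `|beta j 0|, lam ^+ 2 <= beta j 0 ^+ 2 * (c ^+ 2 / 2) &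
         4 * A * Num.sqrt (2 * l0 beta + 1)%:R < c ^+ 2 * `|beta j 0|]) ->
  (forall j, j \in supp b -> lam <= `|b j 0|) ->
  Qobj k lam X (X *m beta + e) b <= Qobj k lam X (X *m beta + e) beta ->
  supp b = supp beta.
Proof.
move=> n0 c0 lam0 A0 sM bM noise Alam betaj blam Qb.
have := basic_inequality n0 A0 (fun j _ => noise j) Qb.
rewrite !sum_pen_ge_lam//; last by move=> j /betaj[].
have kle : (l0 (b - beta) <= l0 b + l0 beta)%N by exact: l0_sub.
(* Each support has size below half the robust spark, so the difference is sparse enough for the
   lower bound. *)
have kM : (l0 (b - beta) < rspark c X)%N.
  rewrite -(@ltn_pmul2l 2)// (leq_ltn_trans (leq_mul (leqnn 2) kle))//.
  by rewrite mulnDr [ltnRHS]mul2n -addnn -addSn leq_add// ltnW.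
have := rspark_lower_bound kM.
set G := _ * l2norm (X *m _); set N := l2norm _; set kd := l0 (b - beta) in kle kM *.
set s := l0 beta in sM Alam betaj kle *; set sh := l0 b in bM kle *.
move=> cNG basic.
have N0 : 0 <= N by exact: l2norm_ge0.
have cN2 : c ^+ 2 * N ^+ 2 <= G ^+ 2.
  have cN0 : 0 <= c * N by rewrite mulr_ge0// ltW.
  by rewrite -exprMn lerXn2r ?nnegrE// (le_trans cN0).
have A2lam : A ^+ 2 * (2 * s + 1)%:R < c ^+ 2 * lam ^+ 2.
  rewrite -(sqr_sqrtr (ler0n _ (2 * s + 1))) -!exprMn ltrXn2r//.
  by rewrite mulr_ge0 ?sqrtr_ge0.
have k2 : Num.sqrt kd%:R ^+ 2 = kd%:R :> R by rewrite sqr_sqrtr ?ler0n.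
have shs : (sh <= s)%N.
  rewrite leqNgt; apply/negP => ssh.
  (* Completing the square in [N] bounds the excess penalty by the noise alone. *)
  have c1 : (sh%:R - s%:R) * (c ^+ 2 * lam ^+ 2) <= A ^+ 2 * kd%:R :> R.
    have := sqr_ge0 (c ^+ 2 * N - A * Num.sqrt kd%:R).
    rewrite sqrrB !exprMn k2 => sq.
    have := ler_wpM2l (sqr_ge0 c) basic.
    have := ler_wpM2l (sqr_ge0 c) cN2.
    lra.
  have sh1 : s%:R + 1 <= sh%:R :> R by rewrite natr1 ler_nat.
  have kR : kd%:R <= sh%:R + s%:R :> R by rewrite -natrD ler_nat.
  have s0 : 0 <= s%:R :> R by exact: ler0n.
  rewrite natrD natrM in A2lam.
  have L0 : 0 < c ^+ 2 * lam ^+ 2 by rewrite mulr_gt0 ?exprn_gt0.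
  have A20 : 0 <= A ^+ 2 by exact: sqr_ge0.
  have c2' : (sh%:R - s%:R) * (c ^+ 2 * lam ^+ 2) <= A ^+ 2 * (sh%:R + s%:R).
    by apply: (le_trans c1); rewrite ler_wpM2l.
  (* Integrality matters: with an excess [sh - s] of at least 1, [sh + s] is at most
     [(2 * s + 1) * (sh - s)], and the lower bound on [lam] gives the contradiction. *)
  have c3 : A ^+ 2 * (sh%:R + s%:R) <= A ^+ 2 * ((2 * s%:R + 1) * (sh%:R - s%:R)).
    by rewrite ler_wpM2l//; nra.
  have c4 : A ^+ 2 * (2 * s%:R + 1) * (sh%:R - s%:R) < c ^+ 2 * lam ^+ 2 * (sh%:R - s%:R).
    by rewrite ltr_pM2r//; lra.
  by lra.
apply/esym/eqP; rewrite eqEcard shs andbT.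
apply/fintype.subsetP => j0 j0S; apply/negPn/negP => j0b.
(* The missed signals. The minimizer vanishes on them, so each contributes its full square to
   [N ^+ 2], and there are at least [s - sh] of them. *)
set Ms := supp beta :\: supp b.
have j0M : j0 \in Ms by rewrite !inE -!in_supp j0b.
have Ncmp j : j \in Ms -> `|beta j 0| <= N.
  rewrite finset.in_setD => /andP[]; rewrite in_supp negbK => /eqP bj _.
  by have := normr_le_l2norm (b - beta) j; rewrite !mxE bj sub0r normrN.
have NM : \sum_(j in Ms) beta j 0 ^+ 2 <= N ^+ 2.
  rewrite sqr_l2norm [leLHS]big_mkcond/=; apply: ler_sum => j _.
  case: ifP => [|_]; last exact: sqr_ge0.
  rewrite finset.in_setD => /andP[]; rewrite in_supp negbK => /eqP bj _.
  by rewrite !mxE bj sub0r sqrrN.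
have cMs : (s <= sh + #|Ms|)%N.
  rewrite /s /sh /l0 -(cardsID (supp b) (supp beta)) leq_add2r.
  by rewrite subset_leq_card// subsetIr.
have lamM : #|Ms|%:R * lam ^+ 2 <= N ^+ 2 * (c ^+ 2 / 2).
  apply: (@le_trans _ _ ((\sum_(j in Ms) beta j 0 ^+ 2) * (c ^+ 2 / 2))); last first.
    by apply: ler_wpM2r => //; rewrite divr_ge0// sqr_ge0.
  rewrite mulr_suml mulr_natl -sumr_const; apply: ler_sum => j.
  by rewrite finset.in_setD => /andP[_ /betaj[]].
have N1 : 0 < N.
  apply: lt_le_trans (Ncmp _ j0M); rewrite normr_gt0 -in_supp//.
have sR : s%:R <= sh%:R + #|Ms|%:R :> R by rewrite -natrD ler_nat.
(* The penalty saved by missing signals is at most [c ^+ 2 * N ^+ 2 / 4], half of the quadratic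
   term, so a quarter of [c ^+ 2 * N ^+ 2] must be paid for by the noise. *)
have quarter : c ^+ 2 * N ^+ 2 <= 4 * (A * (Num.sqrt kd%:R * N)).
  have : s%:R * lam ^+ 2 <= (sh%:R + #|Ms|%:R) * lam ^+ 2.
    by apply: ler_wpM2r => //; exact: sqr_ge0.
  lra.
have cN : c ^+ 2 * N <= 4 * A * Num.sqrt kd%:R.
  by rewrite -(ler_pM2r N1); lra.
have [_ _ bj0] := betaj _ j0S.
(* A single missed signal is at most [N], which the noise now bounds, against the assumed minimal
   signal strength. *)
have : c ^+ 2 * `|beta j0 0| <= 4 * A * Num.sqrt (2 * s + 1)%:R.
  apply: (@le_trans _ _ (c ^+ 2 * N)).
    by apply: ler_wpM2l; rewrite ?sqr_ge0// Ncmp.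
  apply: (le_trans cN); apply: ler_wpM2l; first by rewrite mulr_ge0.
  by rewrite ler_wsqrtr// ler_nat (leq_trans kle)// mul2n -addnn addn1 leqW// leq_add2r.
by rewrite leNgt bj0.
Qed.

Lemma minimizer_support (R : realType) (n p : nat) (k : penalty_kind)
    (c lam A : R) (X : 'M[R]_(n, p)) (beta b : 'cV[R]_p) (e : 'cV[R]_n) :
  (0 < n)%N -> (forall j, \sum_i X i j ^+ 2 = n%:R) ->
  0 < c -> 0 < lam -> 0 <= A ->
  (2 * l0 beta < rspark c X)%N ->
  (forall j, `|\sum_i X i j * e i 0| <= n%:R * A) ->
  A * Num.sqrt (2 * l0 beta + 1)%:R < c * lam ->
  (forall j, j \in supp beta ->
     [/\ lam <= `|beta j 0|, lam ^+ 2 <= beta j 0 ^+ 2 * (c ^+ 2 / 2) &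
         4 * A * Num.sqrt (2 * l0 beta + 1)%:R < c ^+ 2 * `|beta j 0|]) ->
  is_global_min k lam (rspark c X) X (X *m beta + e) b ->
  supp b = supp beta /\ forall j, j \in supp b -> lam <= `|b j 0|.
Proof.
move=> n0 Xn c0 lam0 A0 sM noise Alam betaj.
(* If some entry is below [lam], moving one such entry to 0 and to [+-lam] gives
   two minimizers, each with fewer such entries, whose supports differ. *)
pose small (b : 'cV[R]_p) := [set j | (b j 0 != 0) && (`|b j 0| < lam)]%SET.
have [m] := ubnP #|small b|; elim: m b => // m IH b bm [bM bmin].
have bbeta := bmin _ sM.
have [sm0|[j jsm]] := set_0Vmem (small b).
  have blam j : j \in supp b -> lam <= `|b j 0|.
    rewrite in_supp => bj; rewrite leNgt; apply/negP => blt.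
    have : j \in small b by rewrite inE bj.
    by rewrite sm0 inE.
  by split => //; exact: (support_recovery n0 c0 lam0 A0 sM bM noise Alam betaj blam bbeta).
have := jsm; rewrite inE => /andP[bj0 bjlam].
have [K [z Qz]] := Qobj_coord k lam (X *m beta + e) b n0 (Xn j).
(* Entry [j] is already nonzero, so changing it never enlarges the support and all these vectors
   compete with [b]. *)
have updM v : (2 * l0 (upd b j v) < rspark c X)%N.
  apply: leq_ltn_trans bM; rewrite leq_mul2l/=.
  exact/subset_leq_card/supp_upd_sub.
have bj_min v : (b j 0 - z) ^+ 2 / 2 + pen k lam `|b j 0| <=
    (v - z) ^+ 2 / 2 + pen k lam `|v|.
  by rewrite -(lerD2l K) -!Qz upd_id; exact: bmin.
have [lb|atom] := scalar_threshold lam0 bj0 bj_min.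
  by rewrite ltNge lb in bjlam.
have suppE a : a = 0 \/ a = Num.sg (b j 0) * lam -> supp (upd b j a) = supp beta.
  move=> aE; apply: (IH _ _ _).1.
    rewrite ltnS in bm; apply: leq_trans bm; apply: proper_card; apply/properP; split; last first.
      exists j => //; rewrite inE mxE eqxx negb_and negbK -leNgt.
      case: aE => ->; first by rewrite eqxx.
      by rewrite normrM normr_sg bj0 mul1r gtr0_norm// lexx orbT.
    apply/fintype.subsetP => i; rewrite !inE !mxE; case: (i =P j) => [->|//] _.
    by rewrite bj0.
  split => [|b' b'M]; first exact: updM.
  apply: le_trans (bmin _ b'M); rewrite -[in leRHS](upd_id b j) !Qz lerD2l.
  exact: atom.
have : j \in supp (upd b j (Num.sg (b j 0) * lam)).
  by rewrite in_supp mxE eqxx mulf_neq0 ?sgr_eq0// gt_eqF.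
rewrite suppE; last by right.
by rewrite -(suppE 0); [rewrite in_supp mxE !eqxx|left].
Qed.

(** Equal supports with all entries at least [lam] have equal penalties, which cancel. What remains
    bounds [G ^+ 2] by a multiple of [N], and [c * N <= G] closes the loop. *)
Lemma estimation_bounds (R : realType) (n p : nat) (k : penalty_kind)
    (c lam A : R) (X : 'M[R]_(n, p)) (beta b : 'cV[R]_p) (e : 'cV[R]_n) :
  (0 < n)%N -> 0 < c -> 0 < lam -> 0 <= A ->
  (2 * l0 beta < rspark c X)%N ->
  (forall j, j \in supp beta -> `|\sum_i X i j * e i 0| <= n%:R * A) ->
  (forall j, j \in supp beta -> lam <= `|beta j 0|) ->
  (forall j, j \in supp b -> lam <= `|b j 0|) ->
  supp b = supp beta ->
  Qobj k lam X (X *m beta + e) b <= Qobj k lam X (X *m beta + e) beta ->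
  [/\ (Num.sqrt n%:R)^-1 * l2norm (X *m (b - beta)) <=
        2 * A * c^-1 * Num.sqrt (l0 beta)%:R,
      l2norm (b - beta) <= 2 * (c ^+ 2)^-1 * A * Num.sqrt (l0 beta)%:R &
      forall q, 1 <= q -> q <= 2 ->
        lqnorm q (b - beta) <= 2 * (c ^+ 2)^-1 * A * (l0 beta)%:R `^ q^-1].
Proof.
move=> n0 c0 lam0 A0 sM noise betalam blam suppE Qb.
have sub : supp (b - beta) \subset supp beta.
  apply/fintype.subsetP => j; rewrite in_supp !mxE; apply: contraR => jS.
  have := jS; rewrite -suppE !in_supp !negbK => /eqP ->.
  by move: jS; rewrite in_supp negbK => /eqP ->; rewrite subr0.
have kle : (l0 (b - beta) <= l0 beta)%N by exact: subset_leq_card.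
have := basic_inequality n0 A0 (fun j jd => noise j (fintype.subsetP sub j jd)) Qb.
have l0E : l0 b = l0 beta by rewrite /l0 suppE.
rewrite !sum_pen_ge_lam// l0E addrK.
have kM : (l0 (b - beta) < rspark c X)%N.
  by apply: leq_ltn_trans sM; rewrite mul2n -addnn (leq_trans kle)// leq_addr.
have := rspark_lower_bound kM.
have sqk : Num.sqrt (l0 (b - beta))%:R <= Num.sqrt (l0 beta)%:R :> R.
  by rewrite ler_wsqrtr// ler_nat.
have := l2norm_ge0 (b - beta); have lq := @lqnorm_le_l2norm _ _ (b - beta).
set G := _ * l2norm (X *m _); set N := l2norm _ in lq *.
set ss := Num.sqrt (l0 beta)%:R in sqk *; set sk := Num.sqrt _ in lq sqk *.
move=> N0 cNG basic.
have sk0 : 0 <= sk by exact: sqrtr_ge0.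
have G0 : 0 <= G by apply: le_trans cNG; rewrite mulr_ge0// ltW.
have Gk : c * G <= 2 * A * sk.
  have [->|Gn0] := eqVneq G 0; first by rewrite mulr0 !mulr_ge0.
  have Gp : 0 < G by rewrite lt_def Gn0.
  rewrite -(ler_pM2r Gp).
  have := ler_wpM2l (ltW c0) basic.
  have := ler_wpM2l (mulr_ge0 A0 sk0) cNG.
  by clear; lra.
have Nk : N <= 2 * (c ^+ 2)^-1 * A * sk.
  have -> : 2 * (c ^+ 2)^-1 * A * sk = (2 * A * sk) / c ^+ 2 by clear; ring.
  rewrite ler_pdivlMr ?exprn_gt0// mulrC; apply: le_trans Gk.
  by rewrite expr2 -mulrA ler_wpM2l// ltW.
have cA0 : 0 <= 2 * (c ^+ 2)^-1 * A by rewrite !mulr_ge0 ?invr_ge0 ?sqr_ge0.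
split.
- have -> : 2 * A * c^-1 * ss = (2 * A * ss) / c by clear; ring.
  rewrite ler_pdivlMr// mulrC; apply: (le_trans Gk).
  by apply: ler_wpM2l => //; rewrite mulr_ge0.
- by apply: (le_trans Nk); exact: ler_wpM2l.
move=> q q1 q2; have {lq} := lq _ q1 q2.
have q0 : 0 < q by exact: lt_le_trans q1.
(* A zero difference is treated apart, since the comparison of norms is divided by [sk] below. *)
have [k0|kn0] := eqVneq (l0 (b - beta)) 0%N.
  move=> _; rewrite /lqnorm big1 ?powR0; last 2 first.
  - by rewrite invr_eq0 gt_eqF.
  - move=> i _; have : i \notin supp (b - beta).
      by move/eqP: k0; rewrite cards_eq0 => /eqP ->; rewrite inE.
    by rewrite in_supp negbK => /eqP ->; rewrite normr0 powR0// gt_eqF.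
  by rewrite mulr_ge0// powR_ge0.
have skp : 0 < sk by rewrite sqrtr_gt0 ltr0n lt0n.
move=> lq; rewrite -(ler_pM2r skp); apply: (le_trans lq).
have kq : (l0 (b - beta))%:R `^ q^-1 <= (l0 beta)%:R `^ q^-1 :> R.
  by apply: ge0_ler_powR; rewrite ?invr_ge0 ?nnegrE ?ler0n ?ler_nat// ltW.
apply: (@le_trans _ _ ((l0 beta)%:R `^ q^-1 * N)); first by rewrite ler_wpM2r.
rewrite mulrAC mulrC; apply: ler_wpM2r => //; exact: powR_ge0.
Qed.

(** * From the noise event to the theorem *)

Lemma l0_eq0 (R : realType) (p : nat) (b : 'cV[R]_p) : l0 b = 0%N -> b = 0.
Proof.
move/eqP; rewrite cards_eq0 => /eqP b0; apply/colP => j; rewrite mxE.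
by apply/eqP; rewrite -[_ == 0]negbK -in_supp b0 inE.
Qed.

Lemma l2norm0 (R : realType) (m : nat) : l2norm (0 : 'cV[R]_m) = 0.
Proof. by rewrite /l2norm big1 ?sqrtr0// => i _; rewrite mxE expr0n. Qed.

Lemma lqnorm0 (R : realType) (m : nat) (q : R) : q != 0 -> lqnorm q (0 : 'cV[R]_m) = 0.
Proof.
move=> q0; rewrite /lqnorm big1 ?powR0 ?invr_eq0// => i _.
by rewrite mxE normr0 powR0.
Qed.

Theorem theorem1 (R : realType) (d : measure_display) (T : measurableType d)
  (P : probability T R) (sigma c c2 : R) (p : nat -> nat)
  (X : forall n : nat, 'M[R]_(n, p n)) (beta0 : forall n : nat, 'cV[R]_(p n))
  (lam : nat -> R) (eps : forall n : nat, 'I_n -> {RV P >-> R}) :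
  0 < sigma -> 0 < c -> Num.sqrt 10 * sigma <= c2 ->
  (forall n, gaussian_noise P sigma (eps n)) ->
  (forall n (j : 'I_(p n)), \sum_i (X n i j) ^+ 2 = n%:R) ->
  (forall n, (2 * l0 (beta0 n) < rspark c (X n))%N) ->
  (fun n : nat => (l0 (beta0 n))%:R / n%:R : R) @ \oo --> (0 : R) ->
  (forall n j, j \in supp (beta0 n) ->
     Num.max (Num.sqrt (16 / c ^+ 2)) 1 * c^-1 * c2
       * Num.sqrt ((2 * l0 (beta0 n) + 1)%:R * ln (maxn n (p n))%:R / n%:R)
     < `|beta0 n j 0|) ->
  (forall n, c^-1 * c2
       * Num.sqrt ((2 * l0 (beta0 n) + 1)%:R * ln (maxn n (p n))%:R / n%:R)
     < lam n) ->
  (forall n j, j \in supp (beta0 n) ->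
     lam n < `|beta0 n j 0| * Num.min 1 (Num.sqrt (c ^+ 2 / 2))) ->
  forall (n : nat) (k : penalty_kind) (c2' : R), Num.sqrt 2 * sigma <= c2' ->
  let s := l0 (beta0 n) in
  let pt := (maxn n (p n))%:R : R in
  exists E : set T, measurable E /\
    (E `<=` [set w | forall bh : 'cV[R]_(p n),
        is_global_min k (lam n) (rspark c (X n)) (X n)
          (X n *m beta0 n + noise_vec (eps n) w) bh ->
        [/\ supp bh = supp (beta0 n),
            (Num.sqrt n%:R)^-1 * l2norm (X n *m (bh - beta0 n))
              <= 2 * c2' * c^-1 * Num.sqrt (s%:R * ln (n%:R : R) / n%:R),
            (forall q : R, 1 <= q -> q <= 2 ->
               lqnorm q (bh - beta0 n)
                 <= 2 * (c ^+ 2)^-1 * c2' * powR (s%:R : R) q^-1 * Num.sqrt (ln (n%:R : R) / n%:R))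
          & linfnorm (bh - beta0 n)
              <= 2 * (c ^+ 2)^-1 * c2' * Num.sqrt s%:R * Num.sqrt (ln (n%:R : R) / n%:R)]]) /\
    ((1 - Num.sqrt (2 / pi) * c2^-1 * sigma * powR (ln pt) (- 2^-1)
             * powR pt (1 - c2 ^+ 2 / (2 * sigma ^+ 2))
        - Num.sqrt (2 / pi) * c2'^-1 * sigma * s%:R * powR (ln (n%:R : R)) (- 2^-1)
             * powR (n%:R : R) (- (c2' ^+ 2 / (2 * sigma ^+ 2))))%:E
     <= P E)%E.
Proof.
move=> sigma0 c0 c2sigma noise Xn sM _ betaL lamL lamU n k c2' c2'sigma s pt.
have c20 : 0 < c2 by apply: lt_le_trans c2sigma; rewrite mulr_gt0// sqrtr_gt0.
have c2'0 : 0 < c2' by apply: lt_le_trans c2'sigma; rewrite mulr_gt0// sqrtr_gt0.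
(* For [n <= 1] the robust spark is at most 2, so both the minimizer and the true vector are 0 and
   the whole space serves as the event. *)
have [n1|n1] := leqP n 1.
  have M2 := rspark_le2 (X n) c0 n1.
  have l00 (b : 'cV[R]_(p n)) : (2 * l0 b < rspark c (X n))%N -> b = 0.
    move=> /leq_trans/(_ M2); rewrite -[X in (_ < X)%N]muln1 ltn_pmul2l// ltnS leqn0.
    by move=> /eqP; exact: l0_eq0.
  exists setT; split => //; split; last first.
    rewrite probability_setT lee_fin -addrA -opprD gerBl addr_ge0//.
      by rewrite !mulr_ge0 ?powR_ge0 ?sqrtr_ge0 ?invr_ge0 ?(ltW c20) ?(ltW sigma0).
    by rewrite !mulr_ge0 ?powR_ge0 ?sqrtr_ge0 ?invr_ge0 ?(ltW c2'0) ?(ltW sigma0).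
  move=> w _ bh [bM _]; rewrite (l00 _ bM) (l00 _ (sM n)) subrr mulmx0 l2norm0 mulr0.
  split => //.
  - by rewrite !mulr_ge0 ?sqrtr_ge0 ?invr_ge0 ?(ltW c2'0) ?(ltW c0).
  - move=> q q1 _; rewrite lqnorm0 ?gt_eqF ?(lt_le_trans _ q1)//.
    by rewrite !mulr_ge0 ?sqrtr_ge0 ?powR_ge0 ?invr_ge0 ?sqr_ge0 ?(ltW c2'0).
  - apply: (le_trans (linfnorm_le_l2norm _)); rewrite l2norm0.
    by rewrite !mulr_ge0 ?sqrtr_ge0 ?invr_ge0 ?sqr_ge0 ?(ltW c2'0).
have n0 : (0 < n)%N by exact: ltnW.
have nR : 0 < n%:R :> R by rewrite ltr0n.
(* A measurable event inside the set of good outcomes suffices, so no measurability of the minimizer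
   is involved; from here on the outcome is fixed. *)
have [E [mE Enoise PE]] := noise_event (supp (beta0 n)) sigma0 c20 c2'0 (noise n) n1 (Xn n).
exists E; split => //; split => // w /Enoise[E1 E2] bh bhmin.
have scale m : n%:R * Num.sqrt (m / n%:R) = Num.sqrt (n%:R * m) :> R.
  rewrite -[X in X * _](ger0_norm (ltW nR)) -sqrtr_sqr -sqrtrM ?sqr_ge0//.
  by congr Num.sqrt; field; rewrite gt_eqF.
set e := noise_vec (eps n) w in bhmin.
pose L := ln pt / n%:R.
(* Two noise levels: this one holds for all columns and drives support recovery; the next, at level
   [ln n] on the true support, drives the estimation bounds. *)
have noise1 j : `|\sum_i X n i j * e i 0| <= n%:R * (c2 * Num.sqrt L).
  rewrite mulrCA scale; under eq_bigr do rewrite mxE.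
  exact: E1.
have noise2 j : j \in supp (beta0 n) ->
    `|\sum_i X n i j * e i 0| <= n%:R * (c2' * Num.sqrt (ln n%:R / n%:R)).
  move=> jS; rewrite mulrCA scale; under eq_bigr do rewrite mxE.
  exact: E2.
have sqE : Num.sqrt ((2 * s + 1)%:R * ln pt / n%:R) =
    Num.sqrt (2 * s + 1)%:R * Num.sqrt L by rewrite -mulrA sqrtrM// ler0n.
have A0 : 0 <= c2 * Num.sqrt L by rewrite mulr_ge0 ?sqrtr_ge0// ltW.
have lamn0 : 0 < lam n.
  by apply: le_lt_trans (lamL n); rewrite !mulr_ge0 ?sqrtr_ge0 ?invr_ge0 ?(ltW c20) ?(ltW c0).
have Alam : c2 * Num.sqrt L * Num.sqrt (2 * s + 1)%:R < c * lam n.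
  rewrite -ltr_pdivrMl//; apply: le_lt_trans (lamL n); rewrite sqE.
  by rewrite le_eqVlt; apply/orP; left; apply/eqP; ring.
have betaj j : j \in supp (beta0 n) -> [/\ lam n <= `|beta0 n j 0|,
    lam n ^+ 2 <= beta0 n j 0 ^+ 2 * (c ^+ 2 / 2) &
    4 * (c2 * Num.sqrt L) * Num.sqrt (2 * s + 1)%:R < c ^+ 2 * `|beta0 n j 0|].
  move=> jS; have /ltW lamj := lamU n j jS; split.
  - apply: (le_trans lamj); by rewrite -[leRHS]mulr1 ler_wpM2l.
  - have lamj' : lam n <= `|beta0 n j 0| * Num.sqrt (c ^+ 2 / 2).
      by apply: (le_trans lamj); apply: ler_wpM2l => //; rewrite ge_min lexx orbT.
    have c22 : 0 <= c ^+ 2 / 2 by rewrite divr_ge0// sqr_ge0.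
    rewrite -(sqr_sqrtr c22) -(real_normK (num_real (beta0 n j 0))) -exprMn.
    by rewrite lerXn2r ?nnegrE ?mulr_ge0 ?sqrtr_ge0 ?(ltW lamn0).
  - have := betaL n j jS; rewrite sqE => /(le_lt_trans _) bj.
    have {bj} : (4 / c) * c^-1 * c2 * (Num.sqrt (2 * s + 1)%:R * Num.sqrt L) < `|beta0 n j 0|.
      apply: bj; apply: ler_wpM2r; first by rewrite mulr_ge0 ?sqrtr_ge0.
      apply: ler_wpM2r; first exact: ltW.
      apply: ler_wpM2r; first by rewrite invr_ge0 ltW.
      (* The branch [sqrt (16 / c ^+ 2)], that is [4 / c], supplies the factor 4 required of the
         minimal signal. *)
      rewrite le_max; apply/orP; left.
      rewrite (_ : 16 / c ^+ 2 = (4 / c) ^+ 2); last by field; rewrite gt_eqF.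
      by rewrite sqrtr_sqr ler_norm.
    rewrite -(ltr_pM2l (exprn_gt0 2 c0)); congr (_ < _).
    by field; rewrite gt_eqF.
have [suppE bhlam] := minimizer_support n0 (Xn n) c0 lamn0 A0 (sM n) noise1 Alam betaj bhmin.
have B0 : 0 <= c2' * Num.sqrt (ln n%:R / n%:R) by rewrite mulr_ge0 ?sqrtr_ge0// ltW.
have betalam j : j \in supp (beta0 n) -> lam n <= `|beta0 n j 0| by move=> /betaj[].
have [bh1 bh2 bh3] := estimation_bounds n0 c0 lamn0 B0 (sM n) noise2 betalam bhlam
  suppE (bhmin.2 _ (sM n)).
split => //.
- apply: (le_trans bh1); rewrite -[_ * ln _ / _]mulrA.
  rewrite [Num.sqrt (s%:R * _)]sqrtrM ?ler0n// le_eqVlt.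
  by apply/orP; left; apply/eqP; ring.
- move=> q q1 q2; apply: (le_trans (bh3 q q1 q2)); rewrite le_eqVlt.
  by apply/orP; left; apply/eqP; ring.
(* The sup norm is bounded through the Euclidean one, whence the factor [sqrt s]. *)
- apply: (le_trans (linfnorm_le_l2norm _)); apply: (le_trans bh2); rewrite le_eqVlt.
  by apply/orP; left; apply/eqP; ring.
Qed.
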